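(* Let $\mathbb{F}_q$ be a finite field and let $s\in\mathbb{F}_q$, $s\neq 0$. The eigenvalues of the Radon transform $\mathcal{R}$ of type $\lambda=(2,1)$ in the unipotent Hecke algebra $e_{\psi_s}\mathbb{C}[GL_3(\mathbb{F}_q)]e_{\psi_s}$ form a subset of $\{1,q,q^2,q^3\}$.
   Context: $U_{(2,1)}\subset GL_3(\mathbb{F}_q)$ is the group of block upper triangular matrices with diagonal blocks the identity matrices of sizes $2$ and $1$; $U_{(2,1)}^{op}$ is the group of transposes. For a subgroup $H$, $e_H=\frac{1}{|H|}\sum_{h\in H}h$ in the group algebra. The Radon element is $\mathcal{R}=|U_{(2,1)}|^2e_{U_{(2,1)}}e_{U_{(2,1)}^{op}}e_{U_{(2,1)}}\in\mathbb{C}[GL_3(\mathbb{F}_q)]$. Fix a nontrivial additive character $\psi:(\mathbb{F}_q,+)\to\mathbb{C}^*$ and let $x_{12}(a)=1+aE_{12}$ for $a\in\mathbb{F}_q$. For $s\in\mathbb{F}_q$ put $e_{\psi_s}=q^{-1}e_{U_{(2,1)}}\sum_{a\in\mathbb{F}_q}\overline{\psi(sa)}\,x_{12}(a)$, an idempotent in $\mathbb{C}[GL_3(\mathbb{F}_q)]$. The algebra $e_{\psi_s}\mathbb{C}[GL_3(\mathbb{F}_q)]e_{\psi_s}$ (for $s\ne 0$ a Gelfand-Graev type unipotent Hecke algebra) has unit $e_{\psi_s}$. The element $\mathcal{R}$ commutes with $e_{\psi_s}$, and the eigenvalues of $\mathcal{R}$ in this algebra are those of the linear operator $x\mapsto x\mathcal{R}$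 on $e_{\psi_s}\mathbb{C}[GL_3(\mathbb{F}_q)]e_{\psi_s}$. *)

(* Defs.v *)
From HB Require Import structures.
From mathcomp Require Import all_boot all_order all_algebra all_fingroup.
From mathcomp Require Import mxrepresentation.
From mathcomp Require Import complex reals.

Set Implicit Arguments.
Unset Strict Implicit.
Unset Printing Implicit Defensive.

Import Order.TTheory GRing.Theory Num.Theory.
Local Open Scope ring_scope.

Definition additive_character (F : finFieldType) (C : fieldType)
    (psi : F -> C) : Prop :=
  (forall a, psi a != 0) /\ {morph psi : a b / a + b >-> a * b}.

Definition nontrivial (F : finFieldType) (C : fieldType) (psi : F -> C) : Prop :=
  exists a, psi a != 1.

Section GL3.

Variable F : finFieldType.

Definition unipotent21 (A : 'M[F]_(2 + 1)) : bool :=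
  [&& ulsubmx A == 1%:M, dlsubmx A == 0 & drsubmx A == 1%:M].

Definition U21 : {set {'GL_3[F]}} := [set g : {'GL_3[F]} | unipotent21 (GLval g)].

Definition U21op : {set {'GL_3[F]}} := [set g : {'GL_3[F]} | unipotent21 (GLval g)^T].

Lemma unipotent21_1 : unipotent21 1%:M.
Proof.
by rewrite /unipotent21 (scalar_mx_block 2 1) block_mxKul block_mxKdl block_mxKdr !eqxx.
Qed.

Lemma unipotent21M A B : unipotent21 A -> unipotent21 B -> unipotent21 (A *m B).
Proof.
move=> /and3P[/eqP a1 /eqP a2 /eqP a3] /and3P[/eqP b1 /eqP b2 /eqP b3].
rewrite -[A]submxK -[B]submxK a1 a2 a3 b1 b2 b3 mulmx_block.
rewrite /unipotent21 block_mxKul block_mxKdl block_mxKdr.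
by rewrite !mulmx0 !mul0mx !mulmx1 !addr0 !add0r !eqxx.
Qed.

Lemma U21_group_set : group_set U21.
Proof.
apply/group_setP; split=> [|g h]; rewrite !inE; first exact: unipotent21_1.
exact: unipotent21M.
Qed.
Canonical U21_group := Group U21_group_set.

Lemma U21op_group_set : group_set U21op.
Proof.
apply/group_setP; split=> [|g h]; rewrite !inE.
  by rewrite trmx1; exact: unipotent21_1.
by move=> ug uh; rewrite /= trmx_mul; exact: unipotent21M.
Qed.
Canonical U21op_group := Group U21op_group_set.

Definition x12_mx (a : F) : 'M[F]_3 := 1%:M + a *: delta_mx 0 1.

Lemma x12_unit a : x12_mx a \is a GRing.unit.
Proof.
have h : x12_mx a *m x12_mx (- a) = 1%:M.
  rewrite /x12_mx mulmxDl !mulmxDr !mulmx1 !mul1mx -scalemxAl -scalemxAr.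
  by rewrite mul_delta_mx_0 // !scaler0 addr0 scaleNr addrNK.
by have [] := mulmx1_unit h.
Qed.

Definition x12 (a : F) : {'GL_3[F]} := FinRing.unit _ (x12_unit a).

End GL3.

Section GroupAlgebra.

Variables (C : fieldType) (gT : finGroupType).

(* The group algebra C[gT] is [group_ring C [set: gT]], whose elements are     *)
(* square matrices; the product of C[gT] is *m, and [gelt g] is the element g. *)
Local Notation alg := 'M[C]_#|[set: gT]|.

Definition gelt (g : gT) : alg := regular_repr C [set: gT] g.

Definition avg (H : {group gT}) : alg :=
  (#|H|%:R)^-1 *: \sum_(h in H) gelt h.

Definition in_corner (e x : alg) : Prop :=
  exists2 y, (y \in group_ring C [set: gT])%MS & x = e *m y *m e.

(* Eigenvalues of the operator x |-> x * r on e C[gT] e. *)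
Definition corner_eigenvalue (e r : alg) (c : C) : Prop :=
  exists x, [/\ in_corner e x, x != 0 & x *m r = c *: x].

End GroupAlgebra.

Definition radon (C : fieldType) (F : finFieldType) :=
  let eU := avg C (U21_group F) in
  let eUop := avg C (U21op_group F) in
  (#|U21 F| ^ 2)%:R *: (eU *m eUop *m eU).

Definition e_psi (C : numClosedFieldType) (F : finFieldType)
    (psi : F -> C) (s : F) :=
  (#|F|%:R)^-1 *: (avg C (U21_group F) *m
                   \sum_(a : F) (psi (s * a))^* *: gelt C (x12 a)).

(* Main.v *)
Require Import Defs.
From mathcomp Require Import all_boot all_order all_algebra all_fingroup.
From mathcomp Require Import complex reals.
From mathcomp Require Import mxrepresentation ring.

Set Implicit Arguments.
Unset Strict Implicit.
Unset Printing Implicit Defensive.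

Import GRing.Theory Num.Theory.
Local Open Scope ring_scope.

(** Write q for the order of the field and N for the group of upper
unitriangular matrices. The idempotent of the corner algebra is the idempotent
e attached to the degenerate character of N that is a nontrivial character phi
of the (1, 2) entry and is trivial in the (2, 3) direction. The element e g e
depends on the double coset N g N only, up to a value of phi, and it vanishes
as soon as the two restrictions of the character to the intersection of N with
a conjugate of N disagree. For a monomial g this leaves three Weyl group
elements: the identity, the transposition of the first two coordinates, and the
longest element.

Expanding the opposite unipotent average gives e R e = q^2 e + q^3 B, where B
is the sum over a <> 0 of the elements e w_a e, with w_a the antidiagonal matrix
of rows (0, 0, -1/a), (0, 1, 0), (a, 0, 0) (lemma [corner_opp_sum]). It remains
to find the eigenvalues of B. Let Q be the sum of e h e over the mirabolic group
of the lower triangular matrices h of rows (r, 0, 0), (y, 1, 0), (0, 0, 1/r),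
let D be the sum of the matrices diag(d, d, d^-2), and put W = D B. Bruhat
decompositions of 3 x 3 matrices and character sums show
- q^3 B^2 = q (q - 1)^2 B + (q - 1) Q - W  (lemma [anti1_sum_sqr]),
- q Q B = q (q - 1) B + W  (lemma [mul_mirab_anti1]),
- D B = B D = W and D^2 = (q - 1) D.
The second relation reflects that the sum of the w_a is invariant under the
mirabolic group, modulo the upper unipotent elements that e absorbs.

An eigenvector of B may be chosen to be also an eigenvector of D, since the two
commute; the eigenvalue delta of D is 0 or q - 1. Multiplying the first relation
by B and eliminating Q by the second gives a cubic equation for the eigenvalue
beta of B, with roots
- 0, (q - 1)/q and (1 - q)/q^2 if delta = 0,
- 0, (q - 1)/q and (1 - q^2)/q^3 if delta = q - 1,
so that q^2 + q^3 beta is one of q^2, q^3, q and 1. *)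

(** * Explicit 3 x 3 matrices *)

Section Matrices.
Variable F : fieldType.
Implicit Types a b c d x y z u r : F.

(** Listing the entries reduces an identity between products of matrices to
nine identities between rational functions. *)
Definition mx33 a b c a' b' c' a'' b'' c'' : 'M[F]_3 :=
  \matrix_(i, j) nth 0 (nth [::]
    [:: [:: a; b; c]; [:: a'; b'; c']; [:: a''; b''; c'']] i) j.

Lemma mx33M a b c a' b' c' a'' b'' c'' x y z x' y' z' x'' y'' z'' :
  mx33 a b c a' b' c' a'' b'' c'' *m mx33 x y z x' y' z' x'' y'' z'' =
  mx33 (a * x + b * x' + c * x'') (a * y + b * y' + c * y'')
       (a * z + b * z' + c * z'')
       (a' * x + b' * x' + c' * x'') (a' * y + b' * y' + c' * y'')
       (a' * z + b' * z' + c' * z'')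
       (a'' * x + b'' * x' + c'' * x'') (a'' * y + b'' * y' + c'' * y'')
       (a'' * z + b'' * z' + c'' * z'').
Proof.
apply/matrixP=> i j; rewrite !mxE !big_ord_recl big_ord0 !mxE /= addr0 addrA.
by case: i => [[|[|[|]]]] //= _; case: j => [[|[|[|]]]].
Qed.

Lemma mx33_1 : mx33 1 0 0 0 1 0 0 0 1 = 1%:M.
Proof.
apply/matrixP=> i j; rewrite !mxE.
by case: i => [[|[|[|]]]] //= ?; case: j => [[|[|[|]]]].
Qed.

Definition upper x y z := mx33 1 x z 0 1 y 0 0 1.
Definition opp a b := mx33 1 0 0 0 1 0 a b 1.
(** The (1, 3) entry is the one that makes the determinant 1. *)
Definition anti d z := mx33 0 0 (- (z * d)^-1) 0 d 0 z 0 0.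
(** The elements of GL_2 fixing the second basis vector, with the inverse of
the determinant as third diagonal entry: the mirabolic subgroup of GL_2, inside
SL_3. *)
Definition mirab r y := mx33 r 0 0 y 1 0 0 0 r^-1.
(** The center of the Levi subgroup GL_2 of SL_3. *)
Definition ctorus d := mx33 d 0 0 0 d 0 0 0 (d ^+ 2)^-1.

Lemma upperM a b c x y z :
  upper a b c *m upper x y z = upper (a + x) (b + y) (z + a * y + c).
Proof. by rewrite mx33M /upper; congr mx33; ring. Qed.

End Matrices.

(** * Reindexing sums over a finite field *)

Section Sums.
Variables (F : finFieldType) (V : nmodType).

Lemma sum_nz_reindex (h : F -> F) (f : F -> V) :
    injective h -> h 0 = 0 ->
  \sum_(x | x != 0) f (h x) = \sum_(x | x != 0) f x.
Proof.
move=> inj_h h0; rewrite [RHS](reindex_inj inj_h); apply: eq_bigl => x.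
by rewrite -{2}h0 (inj_eq inj_h).
Qed.

Lemma sum_nz_scale (k : F) (f : F -> V) : k != 0 ->
  \sum_(x | x != 0) f (k * x) = \sum_(x | x != 0) f x.
Proof. by move=> k0; apply: sum_nz_reindex; [exact: mulfI | rewrite mulr0]. Qed.

Lemma sum_scale (k : F) (f : F -> V) : k != 0 ->
  \sum_x f (k * x) = \sum_x f x.
Proof. by move=> k0; rewrite [RHS](reindex_inj (mulfI k0)). Qed.

Lemma sum_nz_inv (f : F -> V) :
  \sum_(x | x != 0) f x^-1 = \sum_(x | x != 0) f x.
Proof. by apply: sum_nz_reindex; [exact: invr_inj | rewrite invr0]. Qed.

Lemma sum_affine (k l : F) (f : F -> V) : k != 0 ->
  \sum_x f (k * x + l) = \sum_x f x.
Proof.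
move=> k0; rewrite [RHS](reindex_inj (addIr l)).
exact: (sum_scale (fun x => f (x + l))).
Qed.

Lemma sum_split0 (f : F -> V) : \sum_x f x = f 0 + \sum_(x | x != 0) f x.
Proof. by rewrite (bigD1 0). Qed.

Lemma sum_upper_shift (a b c : F) (h : F -> F -> F -> V) :
  \sum_x \sum_y \sum_z h (a + x) (b + y) (z + a * y + c) =
  \sum_x \sum_y \sum_z h x y z.
Proof.
rewrite [RHS](reindex_inj (addrI a)); apply: eq_bigr => x _.
rewrite [RHS](reindex_inj (addrI b)); apply: eq_bigr => y _.
rewrite [RHS](reindex_inj (addIr (a * y + c))).
by apply: eq_bigr => z _; rewrite addrA.
Qed.

Lemma sum_upper_shiftr (a b c : F) (h : F -> F -> F -> V) :
  \sum_x \sum_y \sum_z h (x + a) (y + b) (c + x * b + z) =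
  \sum_x \sum_y \sum_z h x y z.
Proof.
rewrite [RHS](reindex_inj (addIr a)); apply: eq_bigr => x _.
rewrite [RHS](reindex_inj (addIr b)); apply: eq_bigr => y _.
by rewrite [RHS](reindex_inj (addrI (c + x * b))).
Qed.
End Sums.

(** * The equation of the eigenvalues *)

(** The hypothesis is the cubic equation that the relations between B, Q and D
impose on an eigenvalue b of B. With c = t^2 + t^3 b, the product of the four
differences c - 1, c - t, c - t^2 and c - t^3 is t^5 times this cubic times the
one difference that the value of delta leaves out. *)
Lemma eigenvalue_mem (K : fieldType) (t b delta : K) :
    (delta == 0) || (delta == t - 1) ->
    t * (t ^+ 3 * b ^+ 2) * b - (t * (t * (t - 1) ^+ 2 * b - b * delta) * b
      + (t - 1) * (t * (t - 1) * b + b * delta)) = 0 ->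
  t ^+ 2 + t ^+ 3 * b \in [:: 1; t; t ^+ 2; t ^+ 3].
Proof.
set c := t ^+ 2 + _ => del poly.
suff : (c - 1) * ((c - t) * ((c - t ^+ 2) * (c - t ^+ 3))) == 0.
  by rewrite !mulf_eq0 !subr_eq0 !inE.
apply/eqP; rewrite /c; case/orP: del poly => /eqP -> poly.
  transitivity ((t ^+ 2 + t ^+ 3 * b - 1) * t ^+ 5 * 0); last by rewrite mulr0.
  by rewrite -[in RHS]poly; ring.
transitivity ((t ^+ 2 + t ^+ 3 * b - t) * t ^+ 5 * 0); last by rewrite mulr0.
by rewrite -[in RHS]poly; ring.
Qed.

(** * Relations in the corner algebra *)

(** Everything takes place in the image of a map rho from all 3 x 3 matrices
that preserves products. Extending a representation of GL_3 by 0 to the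
singular matrices gives such a map, so that invertibility does not enter the
computations. *)
Section Core.
Variables (F : finFieldType) (C : numFieldType) (n : nat).
Variable rho : 'M[F]_3 -> 'M[C]_n.
Hypothesis rhoM : {morph rho : a b / a *m b}.
Hypothesis rho1 : rho 1%:M = 1%:M.
Variable phi : F -> C.
Hypothesis phiD : {morph phi : a b / a + b >-> a * b}.
Hypothesis phi_neq0 : forall a, phi a != 0.
Hypothesis phi_nt : exists a, phi a != 1.

Local Notation q := (#|F|%:R : C).
Implicit Types g h : 'M[F]_3.

Lemma q_neq0 : q != 0.
Proof. by rewrite pnatr_eq0 -lt0n; apply/card_gt0P; exists 0. Qed.
Hint Resolve q_neq0 : core.

Lemma phi0 : phi 0 = 1.
Proof. by apply: (mulfI (phi_neq0 0)); rewrite -phiD addr0 mulr1. Qed.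

Lemma sum_phi k : k != 0 -> \sum_x phi (k * x) = 0.
Proof.
move=> k0; rewrite (sum_scale phi k0); have [a a1] := phi_nt.
apply: (mulfI (x := phi a - 1)); first by rewrite subr_eq0.
rewrite mulr0 mulrBl mul1r mulr_sumr [X in _ - X](reindex_inj (addrI a)).
by rewrite -sumrB big1 // => x _; rewrite phiD subrr.
Qed.

Lemma sum_phi_nz k : k != 0 -> \sum_(x | x != 0) phi (k * x) = -1.
Proof.
move=> /sum_phi; rewrite sum_split0 mulr0 phi0 => /eqP.
by rewrite addrC addr_eq0 => /eqP.
Qed.

Lemma sum_nz_const (V : lmodType C) (v : V) :
  \sum_(x : F | x != 0) v = (q - 1) *: v.
Proof.
rewrite sumr_const -scaler_nat; congr (_ *: v).
by rewrite cardC1 -[in RHS](prednK (ltnW (card_finNzRing_gt1 F))) -natr1 addrK.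
Qed.

Lemma sum_const (V : lmodType C) (v : V) : \sum_(x : F) v = q *: v.
Proof. by rewrite sumr_const -scaler_nat. Qed.

(** Every coefficient in the big Bruhat cell turns out to be a double sum of
this form: for fixed u, the sum over r is - phi (u * k), and the sum of the
latter over u is 1. *)
Lemma sum_phi_phi k l : k != 0 -> l != 0 ->
  \sum_(r | r != 0) \sum_(u | u != 0) phi (u * (k + l * r)) = 1.
Proof.
move=> k0 l0; rewrite exchange_big /=.
under eq_bigr => u u0.
  under eq_bigr => r _ do rewrite mulrDr phiD mulrA.
  rewrite -mulr_sumr sum_phi_nz ?mulf_neq0 // mulrN1 mulrC.
  over.
by rewrite sumrN sum_phi_nz // opprK.
Qed.

(** The idempotent of the character of N that sends a matrix to the value of phi
at its (1, 2) entry; phi (- x) is the inverse of that value. *)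
Definition eN : 'M[C]_n :=
  q ^- 3 *: \sum_x \sum_y \sum_z phi (- x) *: rho (upper x y z).

Lemma rho_eN a b c : rho (upper a b c) *m eN = phi a *: eN.
Proof.
rewrite /eN -scalemxAr scalerA mulrC -scalerA; congr (_ *: _).
rewrite -[in RHS](sum_upper_shift a b c) mulmx_sumr scaler_sumr.
apply: eq_bigr => x _; rewrite mulmx_sumr scaler_sumr.
apply: eq_bigr => y _; rewrite mulmx_sumr scaler_sumr.
apply: eq_bigr => z _; rewrite -scalemxAr -rhoM upperM scalerA -phiD.
by rewrite opprD addNKr.
Qed.

Lemma eN_rho a b c : eN *m rho (upper a b c) = phi a *: eN.
Proof.
rewrite /eN -scalemxAl scalerA mulrC -scalerA; congr (_ *: _).
rewrite -[in RHS](sum_upper_shiftr a b c) mulmx_suml scaler_sumr.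
apply: eq_bigr => x _; rewrite mulmx_suml scaler_sumr.
apply: eq_bigr => y _; rewrite mulmx_suml scaler_sumr.
apply: eq_bigr => z _; rewrite -scalemxAl -rhoM upperM scalerA -phiD.
by rewrite opprD addrCA subrr addr0.
Qed.

Lemma eN_idem : eN *m eN = eN.
Proof.
rewrite {1}/eN -scalemxAl mulmx_suml.
under eq_bigr => x _.
  rewrite mulmx_suml; under eq_bigr => y _.
    rewrite mulmx_suml; under eq_bigr => z _.
      rewrite -scalemxAl rho_eN scalerA -phiD addNr phi0 scale1r; over.
    rewrite sum_const; over.
  rewrite sum_const; over.
rewrite sum_const; move: eN => v; rewrite !scalerA -[RHS]scale1r; congr (_ *: _).
by field.
Qed.

Definition hecke g := eN *m rho g *m eN.

Lemma hecke_upperl a b c g : hecke (upper a b c *m g) = phi a *: hecke g.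
Proof. by rewrite /hecke rhoM mulmxA eN_rho -!scalemxAl. Qed.

Lemma hecke_upperr a b c g : hecke (g *m upper a b c) = phi a *: hecke g.
Proof. by rewrite /hecke rhoM -!mulmxA rho_eN -!scalemxAr. Qed.

Lemma hecke_upperlr a b c a' b' c' g h :
  g = upper a b c *m h *m upper a' b' c' -> hecke g = phi (a + a') *: hecke h.
Proof. by move=> ->; rewrite hecke_upperr hecke_upperl scalerA phiD mulrC. Qed.

(** The character takes the values phi l and 1 on the two sides of an equality
n g = g n', which forces e g e = 0 when phi l <> 1. *)
Lemma hecke_eq0l g :
  (forall l, exists b c b' c', upper l b c *m g = g *m upper 0 b' c') ->
  hecke g = 0.
Proof.
move=> H; have [l l1] := phi_nt; have [b [c [b' [c' eqg]]]] := H l.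
have := hecke_upperl l b c g; rewrite eqg hecke_upperr phi0 scale1r => /esym/eqP.
rewrite -subr_eq0 -{2}[hecke g]scale1r -scalerBl scaler_eq0 subr_eq0 (negPf l1).
by move/eqP.
Qed.

Lemma hecke_eq0r g :
  (forall l, exists b c b' c', g *m upper l b c = upper 0 b' c' *m g) ->
  hecke g = 0.
Proof.
move=> H; have [l l1] := phi_nt; have [b [c [b' [c' eqg]]]] := H l.
have := hecke_upperr l b c g; rewrite eqg hecke_upperl phi0 scale1r => /esym/eqP.
rewrite -subr_eq0 -{2}[hecke g]scale1r -scalerBl scaler_eq0 subr_eq0 (negPf l1).
by move/eqP.
Qed.

(** Only the middle idempotent of e g e e h e is expanded. *)
Lemma hecke_mul g h : hecke g *m hecke h =
  q ^- 3 *: \sum_x \sum_y \sum_z phi (- x) *: hecke (g *m upper x y z *m h).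
Proof.
have -> : hecke g *m hecke h = eN *m rho g *m eN *m (rho h *m eN).
  by rewrite /hecke -!mulmxA (mulmxA eN eN) eN_idem.
rewrite {2}/eN -scalemxAr -scalemxAl; congr (_ *: _).
rewrite mulmx_sumr mulmx_suml; apply: eq_bigr => x _.
rewrite mulmx_sumr mulmx_suml; apply: eq_bigr => y _.
rewrite mulmx_sumr mulmx_suml; apply: eq_bigr => z _.
by rewrite -scalemxAr -scalemxAl /hecke !rhoM !mulmxA.
Qed.

(** In the notation of the introduction, these four sums are B, W, Q and D. *)
Definition anti1_sum := \sum_(a | a != 0) hecke (anti 1 a).
Definition anti_sum := \sum_(d | d != 0) \sum_(z | z != 0) hecke (anti d z).
Definition mirab_sum := \sum_(r | r != 0) \sum_y hecke (mirab r y).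
Definition torus_sum := \sum_(d | d != 0) rho (ctorus d).

Ltac mx := rewrite /upper /opp /anti /mirab /ctorus !mx33M; congr mx33; field;
  repeat (apply/andP; split); rewrite ?oppr_eq0 ?mulf_neq0 ?expf_neq0 //.

(** An opposite unipotent matrix with a <> 0 is in the big cell of the rank one
subgroup on the coordinates 1 and 3; the b entry costs phi (- (b / a)) on the
left and phi (b / a) on the right. *)
Lemma hecke_opp a b : a != 0 -> hecke (opp a b) = hecke (anti 1 a).
Proof.
move=> a0.
rewrite (@hecke_upperlr (- (b / a)) 0 a^-1 (b / a) 0 a^-1 _ (anti 1 a)).
  by rewrite addNr phi0 scale1r.
by mx.
Qed.

(** Conjugation by this matrix, which lies in the rank one subgroup on the
coordinates 2 and 3, moves an element of N with (1, 2) entry l into the (1, 3)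
direction, where the character is trivial. *)
Lemma hecke_opp0 b : b != 0 -> hecke (opp 0 b) = 0.
Proof.
move=> b0; apply: hecke_eq0l => l.
exists 0, (- l / b), 0, (- l / b); mx.
Qed.

Lemma hecke1 : hecke 1%:M = eN.
Proof. by rewrite /hecke rho1 mulmx1 eN_idem. Qed.

(** This computes e R e: among the opposite unipotent matrices only those with
a = b = 0 or a <> 0 survive, and for a <> 0 the q values of b contribute
equally. *)
Lemma corner_opp_sum :
  eN *m (\sum_a \sum_b rho (opp a b)) *m eN = eN + q *: anti1_sum.
Proof.
rewrite mulmx_sumr mulmx_suml sum_split0; congr (_ + _).
  rewrite mulmx_sumr mulmx_suml sum_split0 big1 ?addr0.
    by rewrite -[RHS]hecke1 -mx33_1.
  by move=> b b0; exact: hecke_opp0.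
rewrite scaler_sumr; apply: eq_bigr => a a0.
rewrite mulmx_sumr mulmx_suml -sum_const; apply: eq_bigr => b _.
exact: hecke_opp.
Qed.

(** The products w n w', where w and w' are antidiagonal matrices [anti 1 _] and
n is in N, have this form. *)
Definition lower r u y z := mx33 (- r) 0 0 y 1 0 z u (- r^-1) : 'M[F]_3.

Lemma hecke_lower0 r y z : r != 0 -> z != 0 ->
  hecke (lower r 0 y z) = hecke (anti 1 z).
Proof.
move=> r0 z0.
rewrite (@hecke_upperlr 0 (y / z) (- r / z) 0 (y / z / r) (- (r * z)^-1)
  _ (anti 1 z)).
  by rewrite addr0 phi0 scale1r.
by rewrite /lower; mx.
Qed.

Lemma hecke_lower_z0 r u y : r != 0 -> u != 0 -> hecke (lower r u y 0) = 0.
Proof.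
move=> r0 u0; apply: hecke_eq0r => l.
exists 0, (- l / (r * u)), (l * y / u), (- r * l / u); by rewrite /lower; mx.
Qed.

(** For u <> 0 the case y = z / u is that of the vanishing of the lower left
2 x 2 minor: the matrix is then in the cell of a 3-cycle, which does not support
the character. *)
Lemma hecke_lower_cycle r u y z : r != 0 -> z != 0 -> u != 0 -> y = z / u ->
  hecke (lower r u y z) = 0.
Proof.
move=> r0 z0 u0 ->; apply: hecke_eq0l => l.
exists 0, (- l / u), (z * l / (u ^+ 2 * r ^+ 2)), (- l / (u * r ^+ 2)).
by rewrite /lower; mx.
Qed.

(** Here d is the quotient of the lower left minor by z, up to sign, so that d
and z are the coordinates on the torus in the big cell. *)
Lemma hecke_lower_big r u d z : r != 0 -> z != 0 -> u != 0 -> d != 0 ->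
  hecke (lower r u (z * (1 - d) / u) z) =
  phi (u * (z^-1 + (z * d)^-1 * r)) *: hecke (anti d z).
Proof.
move=> r0 z0 u0 d0.
rewrite (@hecke_upperlr (r * u / (z * d)) ((1 - d) / u) (- r / z)
  (u / z) ((1 - d) / (u * r * d)) (- (r * z)^-1) _ (anti d z)).
  by congr (phi _ *: _); field; rewrite z0 d0.
by rewrite /lower; mx.
Qed.

(** The Bruhat coordinates d and z of the big cell are isolated from the two
parameters r and u that only enter through phi; the latter sum to 1. *)
Lemma sum_anti (k l : F -> F -> F) :
    (forall d z, d != 0 -> z != 0 -> k d z != 0) ->
    (forall d z, d != 0 -> z != 0 -> l d z != 0) ->
  \sum_(r | r != 0) \sum_(u | u != 0) \sum_(z | z != 0) \sum_(d | d != 0)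
     phi (u * (k d z + l d z * r)) *: hecke (anti d z) = anti_sum.
Proof.
move=> k0 l0.
under eq_bigr => r _ do rewrite exchange_big /=.
rewrite exchange_big /= /anti_sum [RHS]exchange_big /=; apply: eq_bigr => z z0.
under eq_bigr => r _ do rewrite exchange_big /=.
rewrite exchange_big /=; apply: eq_bigr => d d0.
under eq_bigr => r _ do rewrite -scaler_suml.
by rewrite -scaler_suml sum_phi_phi ?scale1r ?k0 ?l0.
Qed.

Definition lower_sum r u := \sum_y \sum_z hecke (lower r u y z).

(** For u = 0 the matrices with z = 0 are mirabolic, and those with z <> 0
belong to the antidiagonal terms. *)
Lemma sum_lower0 :
  \sum_(r | r != 0) lower_sum r 0 = mirab_sum + (q * (q - 1)) *: anti1_sum.
Proof.
rewrite /lower_sum; under eq_bigr => r r0.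
  under eq_bigr => y _ do rewrite sum_split0.
  rewrite big_split /=.
  rewrite (_ : \sum_y \sum_(z | z != 0) hecke (lower r 0 y z) =
               q *: anti1_sum); first over.
  rewrite -sum_const; apply: eq_bigr => y _; apply: eq_bigr => z z0.
  exact: hecke_lower0.
rewrite big_split /= sum_nz_const scalerA [(q - 1) * q]mulrC; congr (_ + _).
rewrite /mirab_sum -[RHS](sum_nz_reindex _ (@oppr_inj F)) ?oppr0 //.
by apply: eq_bigr => r r0; apply: eq_bigr => y _; rewrite /mirab invrN.
Qed.

(** For u <> 0 only the big cell contributes. *)
Lemma sum_lower : \sum_(r | r != 0) \sum_(u | u != 0) lower_sum r u = anti_sum.
Proof.
rewrite -[RHS](@sum_anti (fun d z => z^-1) (fun d z => (z * d)^-1)); last first.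
- by move=> d z d0 z0; rewrite invr_neq0 ?mulf_neq0.
- by move=> d z d0 z0; rewrite invr_neq0.
apply: eq_bigr => r r0; apply: eq_bigr => u u0.
rewrite /lower_sum exchange_big /= sum_split0 big1 ?add0r; last first.
  by move=> y _; exact: hecke_lower_z0.
apply: eq_bigr => z z0.
have k0 : - (z / u) != 0 by rewrite oppr_eq0 mulf_neq0 ?invr_neq0.
(* The sum over y becomes a sum over d = 1 - y * u / z. *)
rewrite -(sum_affine (z / u) _ k0) sum_split0 mulr0 add0r hecke_lower_cycle // add0r.
apply: eq_bigr => d d0; rewrite -hecke_lower_big //; congr (hecke (lower _ _ _ _)).
by field.
Qed.

Lemma gauss_inv u :
  \sum_(a | a != 0) phi (- u * a^-1) = if u == 0 then q - 1 else -1.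
Proof.
case: eqP => [->|/eqP u0].
  rewrite (eq_bigr (fun=> 1 : C^o)) => [|a _]; last by rewrite oppr0 mul0r phi0.
  by rewrite sum_nz_const -[RHS]mulr1.
by rewrite (sum_nz_inv (fun a => phi (- u * a))) sum_phi_nz ?oppr_eq0.
Qed.

(** The product [anti 1 a *m upper x y z *m anti 1 b] is [lower r u _ _] with
r = b / a and u = a * x. For fixed r and u the remaining sum over a is a Gauss
sum, equal to q - 1 for u = 0 and to -1 otherwise; these values weight the sums
of [sum_lower0] and [sum_lower]. *)
Lemma anti1_sum_sqr :
  q ^+ 3 *: (anti1_sum *m anti1_sum) = 
    (q * (q - 1) ^+ 2) *: anti1_sum + (q - 1) *: mirab_sum - anti_sum.
Proof.
have -> : q ^+ 3 *: (anti1_sum *m anti1_sum) =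
    \sum_(a | a != 0) \sum_(r | r != 0) \sum_u
    phi (- u * a^-1) *: lower_sum r u.
  rewrite /anti1_sum mulmx_suml scaler_sumr; apply: eq_bigr => a a0.
  rewrite mulmx_sumr scaler_sumr.
  rewrite -[RHS](sum_nz_scale _ (invr_neq0 a0)); apply: eq_bigr => b b0.
  rewrite hecke_mul scalerA divff ?expf_neq0 // scale1r.
  rewrite -[RHS](sum_scale _ a0); apply: eq_bigr => x _.
  rewrite /lower_sum -[in RHS](sum_scale _ b0) scaler_sumr; apply: eq_bigr => y _.
  rewrite -[in RHS](sum_scale _ (mulf_neq0 a0 b0)) scaler_sumr.
  apply: eq_bigr => z _; rewrite mulNr mulrAC divff // mul1r.
  by congr (_ *: hecke _); rewrite /lower; mx.
rewrite exchange_big /=.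
under eq_bigr => r r0.
  rewrite exchange_big sum_split0 /= -scaler_suml gauss_inv eqxx.
  under [X in _ + X]eq_bigr => u u0.
    rewrite -scaler_suml gauss_inv (negPf u0) scaleN1r; over.
  rewrite sumrN; over.
rewrite sumrB -scaler_sumr sum_lower0 sum_lower scalerDr scalerA; congr (_ - _).
rewrite addrC; congr (_ *: _ + _); ring.
Qed.

(** What is left of [mirab r y *m upper x _ _ *m anti 1 a] once multiples of its
last row have been subtracted from the other rows. *)
Definition mirab_anti r x y a :=
  mx33 0 (r * x) (- r / a) 0 (y * x + 1) (- y / a) (a / r) 0 0 : 'M[F]_3.

Lemma hecke_mirab r y x y' z' a : r != 0 -> a != 0 ->
  hecke (mirab r y *m upper x y' z' *m anti 1 a) = hecke (mirab_anti r x y a).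
Proof.
move=> r0 a0.
rewrite [LHS](@hecke_upperlr 0 (y' * r + y * z' * r) (r ^+ 2 * z') 0 0 0
  _ (mirab_anti r x y a)).
  by rewrite addr0 phi0 scale1r.
by mx.
Qed.

Lemma hecke_mirab_x0 r y a : r != 0 -> a != 0 ->
  hecke (mirab_anti r 0 y a) = hecke (anti 1 (a / r)).
Proof.
move=> r0 a0; rewrite (@hecke_upperlr 0 0 0 0 (- y / a) 0 _ (anti 1 (a / r))).
  by rewrite addr0 phi0 scale1r.
by mx.
Qed.

(** As for [hecke_lower_cycle], the matrix is in the cell of a 3-cycle. *)
Lemma hecke_mirab_cycle r y x a : r != 0 -> x != 0 -> a != 0 -> y = - x^-1 ->
  hecke (mirab_anti r x y a) = 0.
Proof.
move=> r0 x0 a0 ->; apply: hecke_eq0l => l.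
by exists 0, 0, (l / (a * r * x ^+ 2)), 0; mx.
Qed.

Lemma hecke_mirab_big r d x a : r != 0 -> x != 0 -> a != 0 -> d != 0 ->
  hecke (mirab_anti r x ((d - 1) / x) a) =
  phi (x * (r / d)) *: hecke (anti d (a / r)).
Proof.
move=> r0 x0 a0 d0.
rewrite (@hecke_upperlr (r * x / d) 0 0 0 (- (d - 1) / (x * a * d)) 0
  _ (anti d (a / r))).
  by congr (phi _ *: _); field.
by mx.
Qed.

(** The terms with x = 0 express that left multiplication by a mirabolic matrix
permutes the antidiagonal terms; those with x <> 0 fall into the big cell, with
d = y * x + 1 as torus coordinate. *)
Lemma mul_mirab_anti1 :
  q *: (mirab_sum *m anti1_sum) = (q * (q - 1)) *: anti1_sum + anti_sum.
Proof.
have -> : q *: (mirab_sum *m anti1_sum) =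
    \sum_(r | r != 0) \sum_x \sum_(a | a != 0) \sum_y
    phi (- x) *: hecke (mirab_anti r x y a).
  rewrite mulmx_suml scaler_sumr; apply: eq_bigr => r r0.
  rewrite mulmx_suml scaler_sumr.
  under eq_bigr => y _.
    rewrite /anti1_sum mulmx_sumr scaler_sumr.
    under eq_bigr => a a0.
      rewrite hecke_mul.
      under eq_bigr => x _.
        under eq_bigr => y' _.
          under eq_bigr => z' _ do rewrite hecke_mirab //.
          rewrite sum_const; over.
        rewrite sum_const; over.
      rewrite -!scaler_sumr !scalerA.
      rewrite (_ : q / _ * _ = 1) ?scale1r; last by field.
      over.
    over.
  rewrite exchange_big [RHS]exchange_big /=; apply: eq_bigr => a a0.
  by rewrite exchange_big.
have -> : (q * (q - 1)) *: anti1_sum = \sum_(r : F | r != 0) q *: anti1_sum.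
  by rewrite sum_nz_const scalerA mulrC.
rewrite -[anti_sum](@sum_anti (fun d z => -1) (fun d z => d^-1)) -?big_split /=; last first.
- by move=> d z d0 z0; rewrite invr_neq0.
- by move=> d z d0 z0; rewrite oppr_eq0 oner_eq0.
apply: eq_bigr => r r0; rewrite sum_split0; congr (_ + _).
  rewrite /anti1_sum scaler_sumr -[RHS](sum_nz_scale _ (invr_neq0 r0)).
  apply: eq_bigr => a a0; rewrite -sum_const; apply: eq_bigr => y _.
  by rewrite oppr0 phi0 scale1r hecke_mirab_x0 // mulrC.
apply: eq_bigr => x x0.
rewrite -[RHS](sum_nz_scale _ (invr_neq0 r0)); apply: eq_bigr => a a0.
(* The sum over y becomes a sum over d = y * x + 1. *)
rewrite -(sum_affine (- x^-1) _ (invr_neq0 x0)) sum_split0.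
rewrite hecke_mirab_cycle ?scaler0 ?add0r ?mulr0 ?add0r //; apply: eq_bigr => d d0.
rewrite (_ : x^-1 * d - x^-1 = (d - 1) / x); last by field.
rewrite hecke_mirab_big // scalerA -phiD [r^-1 * a]mulrC; congr (phi _ *: _).
by field.
Qed.

Lemma ctorus_eN d : d != 0 -> rho (ctorus d) *m eN = eN *m rho (ctorus d).
Proof.
move=> d0; rewrite /eN -scalemxAr -scalemxAl; congr (_ *: _).
have d3 : d ^- 3 != 0 by rewrite invr_neq0 ?expf_neq0.
rewrite mulmx_sumr mulmx_suml; apply: eq_bigr => x _.
rewrite mulmx_sumr mulmx_suml -[LHS](sum_scale _ d3); apply: eq_bigr => y _.
rewrite mulmx_sumr mulmx_suml -[LHS](sum_scale _ d3); apply: eq_bigr => z _.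
by rewrite -scalemxAr -scalemxAl -!rhoM; congr (_ *: rho _); mx.
Qed.

(** The torus elements normalize N, fix its character, and move the antidiagonal
matrices among themselves. *)
Lemma mul_torus_anti1 : torus_sum *m anti1_sum = anti_sum.
Proof.
rewrite mulmx_suml; apply: eq_bigr => d d0.
have d2 : d ^- 2 != 0 by rewrite invr_neq0 ?expf_neq0.
rewrite mulmx_sumr -[RHS](sum_nz_scale _ d2); apply: eq_bigr => a a0.
rewrite /hecke !mulmxA ctorus_eN // -(mulmxA eN) -rhoM; congr (_ *m rho _ *m _).
by mx.
Qed.

Lemma mul_anti1_torus : anti1_sum *m torus_sum = anti_sum.
Proof.
rewrite mulmx_sumr; apply: eq_bigr => d d0.
rewrite mulmx_suml -[RHS](sum_nz_scale _ d0); apply: eq_bigr => a a0.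
rewrite /hecke -!mulmxA -ctorus_eN // (mulmxA (rho _)) -rhoM; congr (_ *m (rho _ *m _)).
by mx.
Qed.

Lemma torus_sum_sqr : torus_sum *m torus_sum = (q - 1) *: torus_sum.
Proof.
rewrite {1}/torus_sum mulmx_suml -sum_nz_const; apply: eq_bigr => c c0.
rewrite mulmx_sumr -[RHS](sum_nz_scale _ c0); apply: eq_bigr => d d0.
rewrite -rhoM; congr rho; mx.
Qed.

(** Replacing x by x D when x D <> 0 makes it an eigenvector of D as well; the
value of the resulting vector under Q need not be known, because only Q B
matters. *)
Lemma eigenvalue_anti1 (x : 'M[C]_n) (beta : C) :
    x != 0 -> x *m anti1_sum = beta *: x ->
  q ^+ 2 + q ^+ 3 * beta \in [:: 1; q; q ^+ 2; q ^+ 3].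
Proof.
move=> x0 x_anti1.
have [y [delta [y0 y_anti1 y_torus del]]] : exists (y : 'M[C]_n) (delta : C),
    [/\ y != 0, y *m anti1_sum = beta *: y, y *m torus_sum = delta *: y 
      & (delta == 0) || (delta == q - 1)].
  have [x_torus|x_torus] := eqVneq (x *m torus_sum) 0.
    by exists x, 0; rewrite x0 x_anti1 x_torus scale0r eqxx.
  exists (x *m torus_sum), (q - 1); rewrite x_torus eqxx orbT -!mulmxA.
  rewrite torus_sum_sqr mul_torus_anti1 -mul_anti1_torus.
  by rewrite mulmxA x_anti1 -scalemxAl -scalemxAr.
have y_anti : y *m anti_sum = (beta * delta) *: y.
  by rewrite -mul_anti1_torus mulmxA y_anti1 -scalemxAl y_torus scalerA.
have y_sqr : (q ^+ 3 * beta ^+ 2) *: y =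
    (q * (q - 1) ^+ 2 * beta - beta * delta) *: y + (q - 1) *: (y *m mirab_sum).
  have := congr1 (mulmx y) anti1_sum_sqr.
  rewrite mulmxBr mulmxDr -!scalemxAr y_anti mulmxA y_anti1 -scalemxAl y_anti1.
  rewrite !scalerA => eq_sqr; rewrite [beta ^+ 2]expr2 mulrA eq_sqr.
  by rewrite [(_ - beta * delta) *: _]scalerBl addrAC.
have y_mirab : q *: (y *m mirab_sum *m anti1_sum) =
    (q * (q - 1) * beta + beta * delta) *: y.
  have := congr1 (mulmx y) mul_mirab_anti1.
  by rewrite mulmxDr -!scalemxAr y_anti y_anti1 scalerA -scalerDl mulmxA.
have /eqP := congr1 (fun v => q *: (v *m anti1_sum)) y_sqr.
rewrite mulmxDl -!scalemxAl y_anti1 scalerDr.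
rewrite (scalerA q (q - 1)) [q * (q - 1)]mulrC -(scalerA (q - 1) q) y_mirab.
rewrite !scalerA -scalerDl.
rewrite -subr_eq0 -scalerBl scaler_eq0 (negPf y0) orbF => /eqP poly.
by apply: eigenvalue_mem del _; exact: poly.
Qed.

End Core.

(** * The group algebra of GL_3 *)

Section GroupAlgebraGL3.
Variables (F : finFieldType) (C : numClosedFieldType).

Lemma gelt1 (gT : finGroupType) : gelt C (1%g : gT) = 1%:M.
Proof. exact: repr_mx1. Qed.

Lemma geltM (gT : finGroupType) (g h : gT) :
  gelt C (g * h)%g = gelt C g *m gelt C h.
Proof. by rewrite /gelt repr_mxM ?inE. Qed.

Definition GLmat (A : 'M[F]_3) : {'GL_3[F]} := insubd (1%g : {'GL_3[F]}) A.

(** The regular representation, extended by 0 to the singular matrices. It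
preserves products because a product is invertible only if both factors
are. *)
Definition rhoGL (A : 'M[F]_3) :=
  if A \in unitmx then gelt C (GLmat A) else 0.

Lemma GLmatK A : A \in unitmx -> GLval (GLmat A) = A.
Proof.
move=> uA; rewrite /GLmat /insubd; case: insubP => [u _ //|].
by rewrite [_ \in _]uA.
Qed.

Lemma GLvalK (g : {'GL_3[F]}) : GLmat (GLval g) = g.
Proof. exact: valKd. Qed.

Lemma rhoGL_val (g : {'GL_3[F]}) : rhoGL (GLval g) = gelt C g.
Proof. by rewrite /rhoGL (valP g) GLvalK. Qed.

Lemma rhoGL1 : rhoGL 1%:M = 1%:M.
Proof.
have -> : 1%:M = GLval (1%g : {'GL_3[F]}) by [].
by rewrite rhoGL_val gelt1.
Qed.

Lemma rhoGLM : {morph rhoGL : X Y / X *m Y}.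
Proof.
move=> X Y; rewrite /rhoGL unitmx_mul.
case uA: (X \in unitmx); last by rewrite mul0mx.
case uB: (Y \in unitmx); last by rewrite mulmx0.
rewrite -geltM; congr (gelt _ _).
apply: val_inj; rewrite [LHS]GLmatK ?unitmx_mul ?uA ?uB //.
by rewrite [RHS](_ : _ = GLval (GLmat X) *m GLval (GLmat Y)) // !GLmatK.
Qed.

Lemma avg_param (H : {group {'GL_3[F]}}) (p : F -> F -> 'M[F]_3) :
    (forall a b a' b', p a b = p a' b' -> a = a' /\ b = b') ->
    (forall a b, p a b \in unitmx) ->
    (forall g : {'GL_3[F]}, reflect (exists a b, GLval g = p a b) (g \in H)) ->
  #|H| = (#|F| ^ 2)%N /\
  avg C H = (#|F|%:R ^- 2) *: \sum_a \sum_b rhoGL (p a b).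
Proof.
move=> inj_p up memH; pose f v := GLmat (p v.1 v.2).
have inj_f : injective f.
  move=> [a b] [a' b'] /(congr1 (@GLval _ _)); rewrite !GLmatK //=.
  by case/inj_p => -> ->.
have eqH : H :=: [set f v | v in [set: F * F]].
  apply/setP=> g; apply/memH/imsetP=> [[a [b gp]]|[v _ ->]].
    by exists (a, b); rewrite ?inE // /f -gp GLvalK.
  by exists v.1, v.2; rewrite GLmatK.
have cardH : #|H| = (#|F| ^ 2)%N by rewrite eqH card_imset // cardsT card_prod.
split=> //; rewrite /avg cardH natrX; congr (_ *: _).
rewrite eqH big_imset /=; last by move=> v w _ _; exact: inj_f.
rewrite pair_big /=; apply: eq_big => [v|v _]; first by rewrite inE.
by rewrite /rhoGL up.
Qed.

Lemma unipotent21P (A : 'M[F]_(2 + 1)) :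
  reflect (exists y z, A = upper 0 y z) (unipotent21 A).
Proof.
apply: (iffP and3P) => [[/eqP h1 /eqP h2 /eqP h3]|[y [z ->]]]; last first.
  split; apply/eqP/matrixP=> i j; rewrite !mxE;
    by case: i => [[|[|[|]]]] //= ?; case: j => [[|[|[|]]]].
exists (A 1 2%:R), (A 0 2%:R); apply/matrixP=> i j.
have ul i' j' : A (lshift 1 i') (lshift 1 j') = (i' == j' :> 'I_2)%:R.
  by have := congr1 (fun M : 'M_2 => M i' j') h1; rewrite !mxE.
have dl i' j' : A (rshift 2 i') (lshift 1 j') = 0.
  by have := congr1 (fun M : 'M_(1, 2) => M i' j') h2; rewrite !mxE.
have dr i' j' : A (rshift 2 i') (rshift 2 j') = (i' == j' :> 'I_1)%:R.
  by have := congr1 (fun M : 'M_1 => M i' j') h3; rewrite !mxE.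
rewrite mxE; case: (@split_ordP 2 1 i) => i' ->; case: (@split_ordP 2 1 j) => j' ->.
- by rewrite ul; case: i' => [[|[|]]] // ?; case: j' => [[|[|]]].
- case: i' => [[|[|[]]]] //= ?; rewrite (ord1 j') /=; congr (A _ _); exact: val_inj.
- by rewrite dl (ord1 i'); case: j' => [[|[|]]].
by rewrite dr (ord1 i') (ord1 j').
Qed.

Lemma upper_unit (a b c : F) : upper a b c \in unitmx.
Proof.
have upperV : upper a b c *m upper (- a) (- b) (a * b - c) = 1%:M.
  by rewrite upperM -mx33_1 /upper; congr mx33; ring.
by have [] := mulmx1_unit upperV.
Qed.

Lemma opp_tr (a b : F) : (opp a b)^T = upper 0 b a.
Proof.
apply/matrixP=> i j; rewrite !mxE.
by case: i => [[|[|[|]]]] // ?; case: j => [[|[|[|]]]].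
Qed.

Lemma upper_inj (x y z x' y' z' : F) :
  upper x y z = upper x' y' z' -> [/\ x = x', y = y' & z = z'].
Proof.
move=> /matrixP eq_upper; split.
- by have := eq_upper 0 1; rewrite !mxE.
- by have := eq_upper 1 2%:R; rewrite !mxE.
by have := eq_upper 0 2%:R; rewrite !mxE.
Qed.

Lemma U21_param : #|U21_group F| = (#|F| ^ 2)%N /\
  avg C (U21_group F) = #|F|%:R ^- 2 *: \sum_y \sum_z rhoGL (upper 0 y z).
Proof.
apply: avg_param => [y z y' z' /upper_inj[] //|y z|g]; first exact: upper_unit.
by rewrite inE; exact: unipotent21P.
Qed.

Lemma U21op_param :
  avg C (U21op_group F) = #|F|%:R ^- 2 *: \sum_a \sum_b rhoGL (opp a b).
Proof.
have [] // := @avg_param (U21op_group F) (@opp F) => [a b a' b'|a b|g].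
- by move=> /(congr1 trmx); rewrite !opp_tr => /upper_inj[].
- by rewrite -unitmx_tr opp_tr upper_unit.
rewrite inE; apply: (iffP (unipotent21P _)) => [[y [z eq_g]]|[a [b ->]]].
  by exists z, y; rewrite -[LHS]trmxK eq_g -opp_tr trmxK.
by exists b, a; rewrite opp_tr.
Qed.

Lemma rho_x12 (a : F) : gelt C (x12 a) = rhoGL (upper a 0 0).
Proof.
rewrite -rhoGL_val; congr rhoGL; apply/matrixP=> i j; rewrite !mxE /=.
by case: i => [[|[|[|]]]] // ?; case: j => [[|[|[|]]]] // ?;
  rewrite /= ?mulr0 ?mulr1 ?addr0 ?add0r.
Qed.

(** The values of psi are roots of unity, since the order of F kills F. *)
Lemma conj_character (psi : F -> C) (a : F) :
  additive_character psi -> (psi a)^* = psi (- a).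
Proof.
move=> [psi_neq0 psiD].
have psi0 : psi 0 = 1.
  by apply: (mulfI (psi_neq0 0)); rewrite -psiD addr0 mulr1.
have psiX m : psi (a *+ m) = psi a ^+ m.
  by elim: m => [|m IHm]; rewrite ?mulr0n ?psi0 // mulrS psiD IHm exprS.
have cardF0 : a *+ #|F| = 0.
  apply: (addIr (\sum_(x : F) x)).
  by rewrite add0r [RHS](reindex_inj (addrI a)) big_split sumr_const.
have norm_psi : `|psi a| = 1.
  apply/eqP; rewrite -(@pexpr_eq1 _ _ #|F|) //; last by apply/card_gt0P; exists a.
  by rewrite -normrX -psiX cardF0 psi0 normr1.
rewrite -[LHS]mulr1 -psi0 -(subrr a) psiD mulrA [_^* * _]mulrC -normCK.
by rewrite norm_psi expr1n mul1r.
Qed.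

Lemma e_psiE (psi : F -> C) (s : F) : additive_character psi ->
  e_psi psi s = eN rhoGL (fun a => psi (s * a)).
Proof.
move=> psi_char; have q0 := q_neq0 F C.
rewrite /e_psi U21_param.2 -scalemxAl scalerA -invfM -exprS; congr (_ *: _).
rewrite mulmx_sumr; apply: eq_bigr => x _.
rewrite mulmx_suml; apply: eq_bigr => y _.
rewrite mulmx_suml; apply: eq_bigr => z _.
rewrite rho_x12 -scalemxAr -rhoGLM upperM conj_character // mulrN.
by rewrite add0r addr0 mul0r !addr0 add0r.
Qed.

Lemma avg_U21_eN (psi : F -> C) : psi 0 = 1 ->
  {morph psi : a b / a + b >-> a * b} ->
  avg C (U21_group F) *m eN rhoGL psi = eN rhoGL psi /\
  eN rhoGL psi *m avg C (U21_group F) = eN rhoGL psi.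
Proof.
move=> psi0 psiD; have q0 := q_neq0 F C; rewrite U21_param.2.
have scaleE (v : 'M[C]_#|[set: {'GL_3[F]}]|) :
    #|F|%:R ^- 2 *: \sum_(y : F) \sum_(z : F) v = v.
  by rewrite !sum_const !scalerA -[RHS]scale1r; congr (_ *: _); field.
split; rewrite -[RHS]scaleE.
  rewrite -scalemxAl; congr (_ *: _); rewrite mulmx_suml; apply: eq_bigr => y _.
  rewrite mulmx_suml; apply: eq_bigr => z _.
  by rewrite (rho_eN rhoGLM psiD) psi0 scale1r.
rewrite -scalemxAr; congr (_ *: _).
rewrite mulmx_sumr; apply: eq_bigr => y _.
rewrite mulmx_sumr; apply: eq_bigr => z _.
by rewrite (eN_rho rhoGLM psiD) psi0 scale1r.
Qed.

End GroupAlgebraGL3.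

(** * Eigenvalues in the corner algebra *)

Lemma corner_absorb (K : fieldType) n (k l : K) (u v e : 'M[K]_n) :
    u *m e = e -> e *m u = e ->
  e *m (k *: (u *m (l *: v) *m u)) *m e = (k * l) *: (e *m v *m e).
Proof.
move=> ue eu; rewrite -!(scalemxAr, scalemxAl) scalerA !mulmxA eu.
by rewrite -(mulmxA (e *m v)) ue.
Qed.

(** On x = x e the operator r acts as e r e. *)
Lemma corner_eigen (K : fieldType) n (a b c : K) (x e r t : 'M[K]_n) :
    b != 0 -> x *m e = x -> x *m r = c *: x -> e *m r *m e = a *: e + b *: t ->
  x *m t = (b^-1 * (c - a)) *: x.
Proof.
move=> b0 xe xr /(congr1 (mulmx x)).
rewrite !mulmxA xe xr -scalemxAl xe mulmxDr -!scalemxAr xe => eq_c.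
by rewrite -scalerA scalerBl eq_c addrC addKr scalerA mulVf // scale1r.
Qed.

Theorem theorem6p11 (R : realType) (F : finFieldType) (psi : F -> R[i])
    (psi_char : additive_character psi) (psi_nontriv : nontrivial psi)
    (s : F) (s_neq0 : s != 0) (c : R[i])
    (c_eig : corner_eigenvalue (e_psi psi s) (radon R[i] F) c) :
  let q : R[i] := #|F|%:R in
  c \in [:: 1; q; q ^+ 2; q ^+ 3].
Proof.
cbv zeta; set q : R[i] := #|F|%:R; have q0 : q != 0 := q_neq0 F _.
pose phi a := psi (s * a); have [psi_neq0 psiD] := psi_char.
have phiD : {morph phi : a b / a + b >-> a * b}.
  by move=> a b; rewrite /phi mulrDr psiD.
have phi_neq0 a : phi a != 0 by exact: psi_neq0.
have phi_nt : exists a, phi a != 1.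
  by have [a a1] := psi_nontriv; exists (s^-1 * a); rewrite /phi mulVKf.
have phi01 := phi0 phiD phi_neq0.
have [x [x_corner x0 xR]] := c_eig.
rewrite e_psiE // -/phi in x_corner.
set e := eN (@rhoGL F R[i]) phi in x_corner.
have ee : e *m e = e := eN_idem (@rhoGLM F R[i]) phiD phi_neq0.
have xe : x *m e = x by case: x_corner => y _ ->; rewrite -mulmxA ee.
have [eUe ueU] := avg_U21_eN phi01 phiD.
have eRe : e *m radon R[i] F *m e =
    q ^+ 2 *: e + q ^+ 3 *: anti1_sum (@rhoGL F R[i]) phi.
  rewrite /radon U21op_param (corner_absorb _ _ _ eUe ueU) (U21_param F R[i]).1.
  rewrite [e *m _ *m e](corner_opp_sum (@rhoGLM F R[i]) (rhoGL1 F R[i])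
    phiD phi_neq0 phi_nt).
  rewrite -/q (_ : _ * q ^- 2 = q ^+ 2).
    by rewrite scalerDr (exprSr q 2); congr (_ + _); exact: scalerA.
  by rewrite -expnM natrX -/q (exprD q 2 2) mulfK ?expf_neq0.
have x_anti1 := corner_eigen (expf_neq0 3 q0) xe xR eRe.
have := eigenvalue_anti1 (@rhoGLM F R[i]) phiD phi_neq0 phi_nt x0 x_anti1.
by rewrite -/q mulrA divff ?expf_neq0 // mul1r addrC subrK.
Qed.
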